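(* For all $n\ge 2$, (a) $\mathcal{J}^{(n)}=\mathcal{J}_{1}^{(n)}=\mathcal{J}_{2}^{(n)}=\mathcal{J}_{3}^{(n)}=\mathcal{J}_{4}^{(n)}$; (b) $\mathcal{J}^{(n)}=\mathcal{J}^{(n+1)}$; (c) $\mathcal{J}=\mathcal{J}^{(2)}$.
   Context: Let $\mathcal{F}$ be the set of all distribution functions of nonnegative random variables with unbounded support. For $F\in\mathcal{F}$ let $X_1,X_2,\ldots$ be i.i.d. nonnegative random variables with distribution function $F$, let $S_n=X_1+\cdots+X_n$, and for $1\le k\le n$ let $X_{k,n}$ be the $k$-th largest among $X_1,\ldots,X_n$ (so $X_{1,n}=\max(X_1,\ldots,X_n)$). Let $\mathcal{G}$ be the set of nonnegative, unbounded and nondecreasing functions $g$ on $[0,\infty)$. The class $\mathcal{J}\subset\mathcal{F}$ is the set of all $F\in\mathcal{F}$ such that for all $n\ge2$, $$\lim_{K\to\infty}\liminf_{x\to\infty}\frac{\mathbb{P}(\max(X_1,\ldots,X_n)>x-K,\;X_1+\cdots+X_n>x)}{\mathbb{P}(X_1+\cdots+X_n>x)}=1.$$ For $n\ge2$ define $$\mathcal{J}_{1}^{(n)}=\{F\in\mathcal{F}:\lim_{K\to\infty}\liminf_{x\to\infty}\mathbb{P}(X_{2,n}\le K\mid S_n>x)=1\},$$ $$\mathcal{J}_{2}^{(n)}=\{F\in\mathcal{F}:\lim_{K\to\infty}\inf_{x\ge0}\mathbb{P}(X_{2,n}\le K\mid S_n>x)=1\},$$ $$\mathcal{J}_{3}^{(n)}=\{F\in\mathcal{F}:\lim_{K\to\infty}\liminf_{x\to\infty}\mathbb{P}(X_{1,n}>x-K\mid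 S_n>x)=1\},$$ $$\mathcal{J}_{4}^{(n)}=\{F\in\mathcal{F}:\lim_{K\to\infty}\liminf_{x\to\infty}\mathbb{P}(X_{1,n}>S_n-K\mid S_n>x)=1\},$$ $$\mathcal{J}^{(n)}=\{F\in\mathcal{F}:\lim_{x\to\infty}\mathbb{P}(X_{2,n}>g(x)\mid S_n>x)=0\ \text{ for all } g\in\mathcal{G}\}.$$ *)

(* Defs.v *)
From HB Require Import structures.
From mathcomp Require Export all_boot all_order all_algebra finmap.
From mathcomp Require Export all_classical all_reals all_analysis.
Export numFieldNormedType.Exports.
Export Order.TTheory GRing.Theory Num.Theory.

Set Implicit Arguments.
Unset Strict Implicit.
Unset Printing Implicit Defensive.

Local Open Scope classical_set_scope.
Local Open Scope ring_scope.

Definition mutually_independent (R : realType) (d : measure_display)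
    (T : measurableType d) (P : probability T R) (I : choiceType)
    (X : I -> {RV P >-> R}) : Prop :=
  forall (A : {fset I}) (B : I -> set R), (forall i, measurable (B i)) ->
    P (\bigcap_(i in [set` A]) (X i @^-1` B i)) =
    (\prod_(i <- A) P (X i @^-1` B i))%E.

(* As usual this is only meaningful when [P B] is positive, which is the case
   for the events [S_n > x] below because the supports are unbounded. *)
Definition cond_prob (R : realType) (d : measure_display)
    (T : measurableType d) (P : probability T R) (A B : set T) : \bar R :=
  (fine (P (A `&` B)) / fine (P B))%:E.

(* The (topological) support of the law of [Y]. *)
Definition law_support (R : realType) (d : measure_display)
    (T : measurableType d) (P : probability T R) (Y : {RV P >-> R}) : set R :=
  [set y | forall U : set R, open U -> U y -> (0 < distribution P Y U)%E].

Definition calF (R : realType) : set (R -> R) :=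
  [set F | exists (d : measure_display) (T : measurableType d)
             (P : probability T R) (Y : {RV P >-> R}),
     [/\ forall w, 0 <= Y w,
         ~ bounded_set (law_support Y) &
         forall r, cdf Y r = (F r)%:E]].

(* Functions on [0, +oo[ are represented by functions on R whose values at
   negative arguments are irrelevant. *)
Definition calG (R : realType) : set (R -> R) :=
  [set g | [/\ forall x, 0 <= x -> 0 <= g x,
               forall x y, 0 <= x -> x <= y -> g x <= g y &
               forall M, exists2 x, 0 <= x & M < g x]].

(* Indices start at 0: [X i] stands for X_{i+1}. *)
Definition iid_nonneg (R : realType) (F : R -> R) (d : measure_display)
    (T : measurableType d) (P : probability T R)
    (X : nat -> {RV P >-> R}) : Prop :=
  [/\ forall i w, 0 <= X i w,
      forall i r, cdf (X i) r = (F r)%:E &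
      mutually_independent X].

(* The elements F of calF such that i.i.d. nonnegative random variables
   X_1, X_2, ... with distribution function F satisfy [Q].  Every [Q] used
   below only involves probabilities of events in the X_i, hence depends only
   on F and not on the sequence chosen to realise it. *)
Definition class_of (R : realType)
    (Q : forall (d : measure_display) (T : measurableType d)
           (P : probability T R), (nat -> {RV P >-> R}) -> Prop) :
    set (R -> R) :=
  [set F | calF F /\
     exists (d : measure_display) (T : measurableType d)
       (P : probability T R) (X : nat -> {RV P >-> R}),
       iid_nonneg F X /\ Q d T P X].

Definition psum (R : realType) (T : Type) (X : nat -> T -> R) (n : nat)
    (w : T) : R :=
  \sum_(i < n) X i w.

(* The k-th largest of the first n variables, counted from k = 1. *)
Definition kth_largest (R : realType) (T : Type) (X : nat -> T -> R)
    (k n : nat) (w : T) : R :=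
  nth 0 (sort >=%R [seq X i w | i <- iota 0 n]) k.-1.

Definition sum_gt (R : realType) (T : Type) (X : nat -> T -> R) (n : nat)
    (x : R) : set T :=
  [set w | x < psum X n w].

(* The default value 0 of the maximum is harmless, the variables being
   nonnegative. *)
Definition classJ (R : realType) : set (R -> R) :=
  class_of (fun d T P X => forall n : nat, (2 <= n)%N ->
    limf_einf (fun x : R =>
      cond_prob P [set w | x - K < \big[Num.max/0]_(i < n) X i w]
                  (sum_gt X n x)) +oo%R @[K --> +oo%R] --> 1%E).

Definition classJ1 (R : realType) (n : nat) : set (R -> R) :=
  class_of (fun d T P X =>
    limf_einf (fun x : R =>
      cond_prob P [set w | kth_largest X 2 n w <= K]
                  (sum_gt X n x)) +oo%R @[K --> +oo%R] --> 1%E).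

Definition classJ2 (R : realType) (n : nat) : set (R -> R) :=
  class_of (fun d T P X =>
    ereal_inf [set cond_prob P [set w | kth_largest X 2 n w <= K]
                 (sum_gt X n x) | x in `[0, +oo[] @[K --> +oo%R] --> 1%E).

Definition classJ3 (R : realType) (n : nat) : set (R -> R) :=
  class_of (fun d T P X =>
    limf_einf (fun x : R =>
      cond_prob P [set w | x - K < kth_largest X 1 n w]
                  (sum_gt X n x)) +oo%R @[K --> +oo%R] --> 1%E).

Definition classJ4 (R : realType) (n : nat) : set (R -> R) :=
  class_of (fun d T P X =>
    limf_einf (fun x : R =>
      cond_prob P [set w | psum X n w - K < kth_largest X 1 n w]
                  (sum_gt X n x)) +oo%R @[K --> +oo%R] --> 1%E).

(* The class J^(n). *)
Definition classJn (R : realType) (n : nat) : set (R -> R) :=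
  class_of (fun d T P X => forall g : R -> R, calG g ->
    cond_prob P [set w | g x < kth_largest X 2 n w]
                (sum_gt X n x) @[x --> +oo%R] --> 0%E).

Arguments classJ R : clear implicits.
Arguments classJ1 R n : clear implicits.
Arguments classJ2 R n : clear implicits.
Arguments classJ3 R n : clear implicits.
Arguments classJ4 R n : clear implicits.
Arguments classJn R n : clear implicits.

(* Main.v *)
From HB Require Import structures.
Require Import Defs.
From mathcomp Require Import perm ring lra.
From mathcomp Require Import unstable measurable_realfun.

(** All the classes are governed by one and the same condition on the sequence,
    [pair_tight X n]: given that [S_n > x], the event that the two variables
    [X 0] and [X 1] both exceed [K] has small probability, uniformly in [x],
    once [K] is large. Since the equivalences below hold for each realisation
    of F separately, the same i.i.d. sequence witnesses membership in all the
    classes ([eq_class_of]), and no uniqueness of joint laws across probability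
    spaces enters.

    For fixed n >= 2, unboundedness of the support makes every probability
    P(S_n > x) positive, so the limits are statements of the form: for every
    e > 0 there is K with P(S_n > x, bad event) <= e P(S_n > x). Two facts
    connect the various bad events. If at most one of the n variables exceeds
    K, that variable is within n K of the sum ([psum_le_one_big]); hence a
    bounded second maximum forces the maximum to be close to S_n, and a
    fortiori close to x. Conversely, two variables above K while the maximum
    exceeds x - K0 cost at most n P(X > x - K0) P(X > K), whereas
    P(S_n > x) >= P(X > x - K0) P(X > K0) ([sum_gt_ge]), so the ratio vanishes
    as K grows ([pair_tight_of_some]). Passing between a given pair of indices
    and the pair 0, 1 is exchangeability ([exchangeable], [pr_pair_sum]), and
    the condition for large x gives the one for all x because
    P(S_n > x) >= P(S_n > x0) > 0 for x <= x0 ([pair_tight_eventually]). The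
    class defined with growing functions g is handled by contraposition: if
    tightness fails at points u_k >= k, then the function
    g(x) = min {k | x <= u_k} grows too slowly.

    Passing from n to n + 1 ([pair_tight_succ]) is Fubini's theorem:
    conditionally on [X n] = z the inequality for n holds at level x - z,
    and integrating over z gives the inequality for n + 1 with the same K.
    Passing from n + 1 to n ([pair_tight_pred]) uses that tightness for n + 1
    forces S_{n+1} > x to be caused by a single variable, which bounds
    P(S_{n+1} > x) by a constant times P(S_n > x). The class J asks for the
    property for every n, so by these steps it reduces to n = 2. *)

Local Open Scope classical_set_scope.
Local Open Scope ring_scope.

Set Implicit Arguments.
Unset Strict Implicit.
Unset Printing Implicit Defensive.

(** * Limits of bounded monotone families of numbers *)

Section limits.
Context (R : realType).

Lemma cvg_to1P (h : R -> \bar R) : (forall K, (h K <= 1)%E) ->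
  h K @[K --> +oo%R] --> 1%E <->
  forall e : R, 0 < e -> exists K0, forall K, K0 <= K -> ((1 - e)%:E <= h K)%E.
Proof.
move=> h1; split.
  move=> hcvg e e0.
  have : nbhs (1%E : \bar R) [set y | ((1 - e)%:E <= y)%E].
    change (nbhs (1 : R) [set r | ((1 - e)%:E <= r%:E)%E]).
    exists e => //= r /=; rewrite ltr_distl => /andP[_ lr].
    by rewrite lee_fin lerBlDr ltW.
  move=> /hcvg [K0 [_ hK0]]; exists (K0 + 1) => K lK.
  by apply: hK0; apply: lt_le_trans lK; rewrite ltrDl.
move=> H A /= A1.
have [e /= e0 eA] : exists2 e : R, 0 < e & forall r : R, `|1 - r| < e -> A r%:E.
  have /nbhs_ballP[e /= e0 eA] : nbhs (1 : R) (fun r => A r%:E) := A1.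
  by exists e.
have [K0 hK0] := H (e / 2) (divr_gt0 e0 (ltr0Sn R 1)).
exists K0; split; first exact: num_real.
move=> K /ltW lK; have := hK0 _ lK; have := h1 K.
change ((h K <= 1)%E -> ((1 - e / 2)%:E <= h K)%E -> A (h K)).
case: (h K) => [r| |] //=; rewrite !lee_fin => r1 r2; apply: eA.
rewrite ger0_norm ?subr_ge0// ltrBlDr -ltrBlDl (lt_le_trans _ r2)//.
by rewrite ltrD2l ltrN2 ltr_pdivrMr// ltr_pMr// ltr1n.
Qed.

(** Monotonicity in K is what lets one good K stand for all the larger ones. *)
Lemma cvg_einf1P (f : R -> R -> R) : (forall K x, f K x <= 1) ->
  (forall K K' x, K <= K' -> f K x <= f K' x) ->
  limf_einf (fun x => (f K x)%:E) +oo%R @[K --> +oo%R] --> 1%E <->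
  forall e : R, 0 < e -> exists K x0, forall x, x0 <= x -> 1 - e <= f K x.
Proof.
move=> f1 fmono.
have h1 K : (limf_einf (fun x => (f K x)%:E) +oo%R <= 1)%E.
  rewrite limf_einfE; apply: ge_ereal_sup => _ [V [x0 [_ hV]] <-].
  apply: ge_ereal_inf; exists (f K (x0 + 1))%:E; last by rewrite lee_fin.
  by exists (x0 + 1) => //; apply: hV; rewrite ltrDl.
rewrite cvg_to1P//; split=> H e e0.
  have [K0 hK0] := H (e / 2) (divr_gt0 e0 (ltr0Sn R 1)).
  have := hK0 _ (lexx _); rewrite limf_einfE => h.
  have : ((1 - e)%:E < ereal_sup [set ereal_inf [set (f K0 x)%:E | x in V] | V in +oo%R])%E.
    apply: lt_le_trans h; rewrite lte_fin ltrD2l ltrN2 ltr_pdivrMr// ltr_pMr// ltr1n //.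
  move=> /ereal_sup_gt[_ [V [x0 [_ hV]] <-] hlt].
  exists K0, (x0 + 1) => x lx; rewrite -lee_fin; apply: le_trans (ltW hlt) _.
  by apply: ereal_inf_lbound; exists x => //; apply: hV; apply: lt_le_trans lx; rewrite ltrDl.
have [K [x0 h]] := H e e0; exists K => K' lK.
rewrite limf_einfE; apply: le_trans (ereal_sup_ubound _) => /=; last first.
  exists [set x | x0 <= x] => //; exists x0; split; [exact: num_real|by move=> x /ltW].
apply: le_ereal_inf_tmp => _ [x /= lx <-]; rewrite lee_fin.
by apply: le_trans (fmono _ _ _ lK); exact: h.
Qed.

Lemma cvg_inf1P (f : R -> R -> R) : (forall K x, f K x <= 1) ->
  (forall K K' x, K <= K' -> f K x <= f K' x) ->
  ereal_inf [set (f K x)%:E | x in `[0, +oo[] @[K --> +oo%R] --> 1%E <->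
  forall e : R, 0 < e -> exists K, forall x, 0 <= x -> 1 - e <= f K x.
Proof.
move=> f1 fmono.
rewrite cvg_to1P; last first.
  move=> K; apply: ge_ereal_inf; exists (f K 0)%:E; last by rewrite lee_fin.
  by exists 0 => //=; rewrite in_itv /= lexx.
split=> H e e0.
  have [K0 hK0] := H e e0; exists K0 => x x0; rewrite -lee_fin.
  apply: le_trans (hK0 _ (lexx _)) _; apply: ereal_inf_lbound; exists x => //=.
  by rewrite in_itv /= x0.
have [K h] := H e e0; exists K => K' lK.
apply: le_ereal_inf_tmp => _ [x /= xI <-].
have x0 : 0 <= x by move: xI; rewrite in_itv /= andbT.
by rewrite lee_fin; apply: le_trans (fmono _ _ _ lK); exact: h.
Qed.

Lemma cvg_EFin0P (f : R -> R) : (forall x, 0 <= f x) ->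
  (f x)%:E @[x --> +oo%R] --> 0%E <->
  forall e : R, 0 < e -> exists x0, forall x, x0 <= x -> f x <= e.
Proof.
move=> f0; split.
  move=> /fine_cvg /= /cvgr0Pnorm_le H e e0.
  have [x0 [_ h]] := H e e0; exists (x0 + 1) => x lx.
  have := h x; rewrite /= ger0_norm//; apply; apply: lt_le_trans lx; rewrite ltrDl //.
move=> H; apply: cvg_EFin; first by near=> x.
apply/cvgr0Pnorm_le => e e0; have [x0 h] := H e e0.
by exists x0; split; [exact: num_real|move=> x /ltW lx /=; rewrite ger0_norm// h].
Unshelve. all: by end_near. Qed.

End limits.

(** * Order statistics and the number of large terms *)

(** In a decreasing list the entries above y form a prefix, so comparing the
    entry at position k with y amounts to comparing k with their number. *)
Lemma lt_nth_sorted (R : realType) (s : seq R) (k : nat) (y : R) :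
  sorted >=%R s -> (k < size s)%N ->
  (y < nth 0 s k) = (k < count (fun z => y < z)%R s)%N.
Proof.
elim: s k => [|a s IH] k //= ps ks.
have smax z : z \in s -> z <= a.
  by move=> zs; have /allP/(_ z zs) := order_path_min (fun _ _ _ h1 h2 => le_trans h2 h1) ps.
have c0 : ~~ (y < a) -> count (fun z => y < z) s = 0%N.
  rewrite -leNgt => ay; apply/eqP; rewrite -leqn0 leqNgt -has_count.
  by apply/hasPn => z /smax za; rewrite -leNgt (le_trans za).
case: k ks => [|k] /= ks.
  by case: ltP => ya; rewrite //= c0// -leNgt.
rewrite IH//; last exact: path_sorted ps.
by case: (boolP (y < a)) => // /c0 ->.
Qed.

Section order_statistics.
Context (R : realType) (T : Type) (X : nat -> T -> R).

Definition some_gt n (y : R) : set T := [set w | exists i : 'I_n, y < X i w].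

Definition two_gt n (y : R) : set T :=
  [set w | exists i j : 'I_n, [/\ i != j, y < X i w & y < X j w]].

Lemma lt_kth_largest k n y w : (0 < k <= n)%N ->
  (y < kth_largest X k n w) = (k <= #|[pred i : 'I_n | (y < X i w)%R]|)%N.
Proof.
move=> /andP[k0 kn]; rewrite /kth_largest lt_nth_sorted; last 2 first.
- by apply: sort_sorted => a b; rewrite /= orbC; exact: le_total.
- by rewrite size_sort size_map size_iota prednK.
rewrite prednK// (seq.permP (permEl (perm_sort _ _))) count_map -val_enum_ord count_map.
by rewrite enumT -size_filter cardE /enum_mem; congr (_ <= size _)%N.
Qed.

Lemma kth_largest1 n y w : (0 < n)%N -> (y < kth_largest X 1 n w) <-> some_gt n y w.
Proof.
move=> n0; rewrite lt_kth_largest ?n0//; split.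
  by move=> /card_gt0P[i]; rewrite inE; exists i.
by move=> [i yi]; apply/card_gt0P; exists i; rewrite inE.
Qed.

Lemma kth_largest2 n y w : (1 < n)%N -> (y < kth_largest X 2 n w) <-> two_gt n y w.
Proof.
move=> n1; rewrite lt_kth_largest ?n1//; split.
  by move=> /card_gt1P[i [j]]; rewrite !inE => -[yi yj ij]; exists i, j.
by move=> [i [j [ij yi yj]]]; apply/card_gt1P; exists i, j; rewrite !inE.
Qed.

Lemma bigmax_some_gt n y w : (forall i, 0 <= X i w) -> (0 < n)%N ->
  (y < \big[Num.max/0]_(i < n) X i w) <-> some_gt n y w.
Proof.
move=> X0 n0; split.
  move=> h; apply: contrapT => no; move: h; apply/negP; rewrite -leNgt.
  apply/bigmax_leP; split=> [|i _].
    apply: (@le_trans _ _ (X 0 w)) => //; rewrite leNgt; apply/negP => h.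
    by apply: no; exists (Ordinal n0).
  by rewrite leNgt; apply/negP => h; apply: no; exists i.
by move=> [i h]; apply: lt_le_trans h _; exact: le_bigmax.
Qed.

(** The deterministic core of the principle of a single big jump: when at most
    one term exceeds y, all the others together contribute at most n y. *)
Lemma psum_le_one_big n y w :
  (forall i, 0 <= X i w) -> (0 < n)%N -> 0 <= y -> ~ two_gt n y w ->
  exists i : 'I_n, psum X n w <= X i w + n%:R * y.
Proof.
move=> X0 n0 y0 no.
have [i hi] : exists i : 'I_n, forall j : 'I_n, j != i -> X j w <= y.
  have [[i hi]|h] := pselect (some_gt n y w).
    exists i => j ji; rewrite leNgt; apply/negP => hj; apply: no; exists i, j.
    by rewrite eq_sym.
  by exists (Ordinal n0) => j _; rewrite leNgt; apply/negP => hj; apply: h; exists j.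
exists i; rewrite /psum (bigD1 i)//= lerD2l.
apply: (@le_trans _ _ (\sum_(j < n | j != i) y)); first exact: ler_sum.
apply: (@le_trans _ _ (\sum_(j < n) y)); last by rewrite sumr_const card_ord mulr_natl.
by rewrite [leRHS](bigD1 i)//= lerDr.
Qed.

End order_statistics.

(** * Joint laws of i.i.d. sequences *)

Lemma preimage_ray (R : realType) (T : Type) (f : T -> R) c :
  f @^-1` `]c, +oo[%classic = [set t | c < f t].
Proof. by apply/seteqP; split=> t; rewrite /preimage /= in_itv /= andbT. Qed.

Lemma measurable_lt_fun (R : realType) d (T : measurableType d) (f : T -> R) c :
  measurable_fun setT f -> measurable [set t | c < f t].
Proof.
by move=> mf; rewrite -preimage_ray -[X in measurable X]setTI; apply: mf.
Qed.

Section finite_laws.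
Context (R : realType).

(** The rays ]x, +oo[ are stable under intersection and generate the Borel sets. *)
Lemma eq_law_ray (mu1 mu2 : {measure set R -> \bar R}) :
  (mu1 setT < +oo)%E ->
  (forall x, mu1 `]x, +oo[%classic = mu2 `]x, +oo[%classic) ->
  forall B, measurable B -> mu1 B = mu2 B.
Proof.
move=> fin1 e; apply: (measure_unique (@RGenOInfty.G R)
  (fun k => `](- k%:R), +oo[%classic)).
- exact: RGenOInfty.measurableE.
- move=> _ _ [x ->] [y ->]; exists (Num.max x y).
  by apply/seteqP; split=> z /=; rewrite !in_itv /= !andbT gt_max => /andP.
- by move=> k; exists (- k%:R).
- rewrite -subTset => x _; exists (Num.bound x) => //=.
  by rewrite in_itv /= andbT ltrNl ltrNbound.
- by move=> _ [x ->].
- by move=> k; apply: le_lt_trans fin1; apply: le_measure; rewrite ?inE.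
Qed.

Definition box n (B : 'I_n -> set R) : set (n.-tuple R) :=
  [set t | forall i, B i (tnth t i)].

Lemma measurable_box n (B : 'I_n -> set R) :
  (forall i, measurable (B i)) -> measurable (box B).
Proof.
move=> mB; have -> : box B = \bigcap_(i in [set: 'I_n]) (fun t => tnth t i) @^-1` B i.
  by apply/seteqP; split=> t /= h i; [move=> _; exact: h|exact: h].
apply: fin_bigcap_measurable => // i _.
by rewrite -[_ @^-1` _]setTI; exact: measurable_tnth.
Qed.

(** The boxes are stable under intersection and generate the product
    sigma-algebra; this one lemma yields both exchangeability and the
    independence of a block of variables from the next one. *)
Lemma eq_law_box n (mu1 mu2 : {measure set (n.-tuple R) -> \bar R}) :
  (mu1 setT < +oo)%E ->
  (forall B, (forall i, measurable (B i)) -> mu1 (box B) = mu2 (box B)) ->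
  forall E, measurable E -> mu1 E = mu2 E.
Proof.
move=> fin1 e.
pose G := [set A | exists2 B : 'I_n -> set R, forall i, measurable (B i) & A = box B].
have GT : G setT.
  exists (fun=> setT) => //; apply/seteqP; split=> // t _ i //.
apply: (measure_unique G (fun=> setT)) => //.
- apply/seteqP; split; last first.
    apply: smallest_sub; first exact: sigma_algebra_measurable.
    by move=> _ [B mB ->]; exact: measurable_box.
  apply: smallest_sub; first exact: smallest_sigma_algebra.
  (* A generator constrains a single coordinate i: it is the box whose other
     sides are the whole line. *)
  rewrite -bigcup_seq => A [i _ [B mB <-]].
  apply: sub_sigma_algebra; exists (fun j => if j == i then B else setT).
    by move=> j; case: ifP.
  apply/seteqP; split=> t /=.
    by move=> [_ h] j; case: eqP => [->|].
  by move=> /(_ i); rewrite eqxx.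
- move=> _ _ [B mB ->] [C mC ->]; exists (fun i => B i `&` C i).
    by move=> i; exact: measurableI.
  apply/seteqP; split=> t /=; first by move=> [b c] i; split; [exact: b|exact: c].
  by move=> h; split=> i; case: (h i).
- by apply/seteqP; split=> // x _; exists 0%N.
- by move=> _ [B mB ->]; exact: e.
Qed.

End finite_laws.

Section sequence.
Context (R : realType) d (T : measurableType d) (P : probability T R).
Variable X : nat -> {RV P >-> R}.
Hypothesis indX : mutually_independent X.
Hypothesis idX : forall i j r, cdf (X i) r = cdf (X j) r.

Lemma eq_law i j B : measurable B -> P (X i @^-1` B) = P (X j @^-1` B).
Proof.
apply: (eq_law_ray (mu1 := distribution P (X i)) (mu2 := distribution P (X j))).
  by rewrite /= /distribution /pushforward preimage_setT probability_setT ltry.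
by move=> x; have := ccdf_1_cdf (X i) x; rewrite (idX i j) -ccdf_1_cdf.
Qed.

Lemma prob_inj n (s : 'I_n -> nat) (B : 'I_n -> set R) : injective s ->
  (forall i, measurable (B i)) ->
  P [set w | forall i, B i (X (s i) w)] = (\prod_(i < n) P (X 0 @^-1` B i))%E.
Proof.
move=> sinj mB.
(* Independence speaks of a family of sets indexed by the values of s: the set
   attached to s i is B i because s is injective, and the line elsewhere. *)
pose C (j : nat) : set R := \bigcap_(i in [set i : 'I_n | s i == j]) B i.
have CE i : C (s i) = B i.
  apply/seteqP; split=> r; first by move=> /(_ i); apply => /=.
  by move=> Br k /= /eqP /sinj ->.
have mC j : measurable (C j) by apply: fin_bigcap_measurable.
have := indX [fset s i | i in 'I_n]%fset mC.
rewrite big_imfset /=; last by move=> ? ? _ _; exact: sinj.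
rewrite big_enum /= => H.
transitivity (P (\bigcap_(i in [set` [fset s i | i in 'I_n]%fset]) X i @^-1` C i)).
  congr (P _); apply/seteqP; split=> w /=.
    by move=> h j /imfsetP[i _ ->]; rewrite /preimage /= CE.
  by move=> h i; rewrite -CE; apply: h => /=; apply/imfsetP; exists i.
rewrite H; apply: eq_bigr => i _; rewrite CE; exact: eq_law.
Qed.

Definition vec n (s : 'I_n -> nat) (w : T) : n.-tuple R :=
  [tuple X (s i) w | i < n].

Lemma measurable_vec n (s : 'I_n -> nat) : measurable_fun setT (vec s).
Proof.
apply/measurable_fun_tnthP => i.
rewrite (_ : _ \o _ = X (s i)); first exact: measurable_funPT.
by apply/funext => w /=; rewrite tnth_mktuple.
Qed.

HB.instance Definition _ n (s : 'I_n -> nat) :=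
  @isMeasurableFun.Build _ _ _ _ (vec s) (measurable_vec s).

Lemma vec_preimage_box n (s : 'I_n -> nat) (B : 'I_n -> set R) :
  vec s @^-1` box B = [set w | forall i, B i (X (s i) w)].
Proof.
by apply/seteqP; split=> w h i; have := h i; rewrite tnth_mktuple.
Qed.

(** By independence and equality of the marginals, both vectors give a box the
    product of the probabilities of its sides. *)
Lemma exchangeable n (s t : 'I_n -> nat) E : injective s -> injective t ->
  measurable E -> P (vec s @^-1` E) = P (vec t @^-1` E).
Proof.
move=> sinj tinj.
apply: (eq_law_box (mu1 := distribution P (vec s)) (mu2 := distribution P (vec t))).
  by rewrite /= /distribution /pushforward preimage_setT probability_setT ltry.
move=> B mB; rewrite /= /distribution /pushforward /= !vec_preimage_box.
by rewrite !prob_inj.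
Qed.

(** For fixed B both sides are finite measures in E, which agree on boxes
    because a box for n variables and a set B form a box for n + 1 variables. *)
Lemma vec_independent n B E : measurable B -> measurable E ->
  P (X n @^-1` B `&` vec (@nat_of_ord n) @^-1` E) =
  (P (X n @^-1` B) * P (vec (@nat_of_ord n) @^-1` E))%E.
Proof.
move=> mB mE.
have mXB : measurable (X n @^-1` B) by exact: measurable_funPTI.
have b0 : 0 <= fine (P (X n @^-1` B)) by rewrite fine_ge0.
pose mu1 := pushforward (mrestr P mXB) (vec (@nat_of_ord n)).
pose mu2 := mscale (NngNum b0) (distribution P (vec (@nat_of_ord n))).
rewrite setIC -[LHS]/(mu1 E).
have -> : (P (X n @^-1` B) * P (vec (@nat_of_ord n) @^-1` E))%E = mu2 E.
  by rewrite /mu2 /mscale /= fineK// fin_num_measure.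
move: E mE; apply: eq_law_box.
  rewrite /mu1 /= /pushforward /mrestr preimage_setT setTI.
  by rewrite (le_lt_trans (probability_le1 _ _))// ltry.
move=> A mA; rewrite /mu1 /mu2 /= /mscale /pushforward /mrestr /= /distribution /pushforward.
rewrite vec_preimage_box fineK ?fin_num_measure// prob_inj//; last exact: val_inj.
pose A' (i : 'I_n.+1) := if unlift ord_max i is Some j then A j else B.
have mA' i : measurable (A' i) by rewrite /A'; case: unliftP.
have := prob_inj val_inj mA'; rewrite big_ord_recr /=.
have -> : A' ord_max = B by rewrite /A' unlift_none.
rewrite muleC => e.
transitivity (P (X 0 @^-1` B) * \prod_(i < n) P (X 0 @^-1` A i))%E; last first.
  by congr (_ * _)%E; exact: eq_law.
have lE (i : 'I_n) : widen_ord (leqnSn n) i = lift ord_max i.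
  by apply/val_inj; rewrite /= /bump leqNgt ltn_ord.
rewrite (eq_bigr (fun i : 'I_n => P (X 0 @^-1` A' (widen_ord (leqnSn n) i)))); last first.
  by move=> i _; rewrite /A' lE liftK.
rewrite -e; congr (P _); apply/seteqP; split=> w /=.
  move=> [h hB] i; rewrite /A'; case: unliftP => [j ->|->] //=.
  by rewrite /bump leqNgt ltn_ord; exact: h.
move=> h; split=> [i|]; last by have := h ord_max; rewrite /A' unlift_none.
by have := h (lift ord_max i); rewrite /A' liftK /= /bump leqNgt ltn_ord.
Qed.

(** Fubini's theorem for the pair of independent variables [X n] and
    [(X 0, ..., X (n - 1))]: the integrand is the probability of the event given
    that [X n] equals z. *)
Lemma prob_add_next n (E : set (n.-tuple R)) x : measurable E ->
  P [set w | E (vec (@nat_of_ord n) w) /\ x < psum X n.+1 w] =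
  (\int[distribution P (X n)]_z
     P [set w | E (vec (@nat_of_ord n) w) /\ (x - z < psum X n w)%R])%E.
Proof.
move=> mE.
pose V := vec (@nat_of_ord n).
have mZV : measurable_fun setT (fun w => (X n w, V w)).
  by apply/measurable_fun_pairP; split; [exact: measurable_funPT|exact: measurable_vec].
pose mu : {measure set (R * n.-tuple R) -> \bar R} := pushforward P (fun w => (X n w, V w)).
pose S (t : n.-tuple R) := \sum_(i < n) tnth t i.
have mS : measurable_fun setT S by apply: measurable_sum => i; exact: measurable_tnth.
pose C := [set p : R * n.-tuple R | E p.2 /\ x < p.1 + S p.2].
have mC : measurable C.
  apply: measurableI.
    by rewrite -[X in measurable X]setTI; exact: measurable_snd.
  apply: measurable_lt_fun.
  by apply: measurable_funD => //; exact: measurableT_comp.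
have SV w : S (V w) = psum X n w.
  by apply: eq_bigr => i _; rewrite tnth_mktuple.
have := product_measure_unique (m1 := distribution P (X n)) (m2 := distribution P V) (m' := mu mZV).
move=> /(_ _ C mC) H.
rewrite (_ : P _ = mu mZV C); last first.
  congr (P _); apply/seteqP; split=> w; rewrite /C /preimage /= SV /psum big_ord_recr /= addrC //.
rewrite -H; last by move=> A B mA mB; exact: vec_independent.
apply: eq_integral => z _ /=; rewrite /distribution /pushforward.
congr (P _); apply/seteqP; split=> w /=; rewrite /xsection /= inE /C /= SV ltrBlDl //.
Qed.

End sequence.

(** * Conditional probabilities as inequalities between real numbers *)

Section real_probability.
Context (R : realType) d (T : measurableType d) (P : probability T R).

Definition pr (A : set T) : R := fine (P A).

Lemma prE A : measurable A -> P A = (pr A)%:E.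
Proof. by move=> mA; rewrite /pr fineK// fin_num_measure. Qed.

Lemma pr_ge0 A : 0 <= pr A.
Proof. exact: fine_ge0. Qed.

Lemma pr_le A B : measurable A -> measurable B -> A `<=` B -> pr A <= pr B.
Proof.
by move=> mA mB AB; rewrite -lee_fin -!prE//; apply: le_measure; rewrite ?inE.
Qed.

Lemma measurable_exists (I : finType) (A : I -> set T) :
  (forall i, measurable (A i)) -> measurable [set w | exists i, A i w].
Proof.
move=> mA; rewrite (_ : [set _ | _] = \bigcup_(i in [set: I]) A i).
  exact: fin_bigcup_measurable.
by apply/seteqP; split=> w /= [i]; [exists i|exists i].
Qed.

Lemma pr_setU A B : measurable A -> measurable B -> pr (A `|` B) <= pr A + pr B.
Proof.
move=> mA mB; rewrite -lee_fin EFinD -!prE//; last exact: measurableU.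
exact: measureU2.
Qed.

Lemma pr_exists (I : finType) (A : I -> set T) : (forall i, measurable (A i)) ->
  pr [set w | exists i, A i w] <= \sum_i pr (A i).
Proof.
move=> mA.
rewrite (_ : [set _ | _] = \big[setU/set0]_(i : I) A i); last first.
  rewrite -bigcup_seq; apply/seteqP; split=> w /= [i]; last by exists i.
  by exists i => //=; rewrite mem_index_enum.
elim: (index_enum I) => [|i s IH]; first by rewrite !big_nil /pr measure0.
rewrite !big_cons (le_trans (pr_setU _ _))//; last by rewrite lerD2l.
exact: bigsetU_measurable.
Qed.

Lemma cond_prob_ge A B e : measurable A -> measurable B -> 0 < pr B ->
  (1 - e <= fine (cond_prob P A B)) <-> (pr (B `\` A) <= e * pr B).
Proof.
move=> mA mB B0.
have -> : fine (cond_prob P A B) = 1 - pr (B `\` A) / pr B.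
  apply: (mulIf (lt0r_neq0 B0)); rewrite /cond_prob /= -/(pr _) -/(pr B).
  rewrite mulrBl !divfK ?lt0r_neq0// mul1r.
  have : P B = (P (B `\` A) + P (B `&` A))%E by exact: measureDI.
  rewrite !prE//; [|exact: measurableI|exact: measurableD].
  by move=> [->]; rewrite setIC addrC addrK.
by rewrite lerD2l lerN2 ler_pdivrMr.
Qed.

Lemma cond_prob_le1 A B : measurable A -> measurable B -> fine (cond_prob P A B) <= 1.
Proof.
move=> mA mB; rewrite /cond_prob /= -/(pr _) -/(pr B).
have [->|B0] := eqVneq (pr B) 0; first by rewrite invr0 mulr0.
rewrite ler_pdivrMr ?lt_def ?B0 ?pr_ge0// mul1r; apply: pr_le => //.
exact: measurableI.
Qed.

Lemma cond_prob_mono A A' B : measurable A -> measurable A' -> measurable B ->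
  A `<=` A' -> fine (cond_prob P A B) <= fine (cond_prob P A' B).
Proof.
move=> mA mA' mB AA'; rewrite /cond_prob /= -!/(pr _).
apply: ler_wpM2r; first by rewrite invr_ge0 pr_ge0.
by apply: pr_le; [exact: measurableI|exact: measurableI|exact: setSI].
Qed.

Lemma cond_prob_einfP (A : R -> R -> set T) (B : R -> set T) :
  (forall K x, measurable (A K x)) -> (forall x, measurable (B x)) ->
  (forall x, 0 < pr (B x)) ->
  (forall K K' x, K <= K' -> A K x `<=` A K' x) ->
  limf_einf (fun x => cond_prob P (A K x) (B x)) +oo%R @[K --> +oo%R] --> 1%E <->
  forall e : R, 0 < e -> exists K x0, forall x, x0 <= x ->
    pr (B x `\` A K x) <= e * pr (B x).
Proof.
move=> mA mB B0 Amono.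
have := cvg_einf1P (f := fun K x => fine (cond_prob P (A K x) (B x))).
move=> /(_ (fun _ _ => cond_prob_le1 (mA _ _) (mB _))).
move=> /(_ (fun _ _ _ KK => cond_prob_mono (mA _ _) (mA _ _) (mB _) (Amono _ _ _ KK))) H.
apply: (iff_trans H); split=> h e /h[K [x0 hx]]; exists K, x0 => x /hx;
  by rewrite cond_prob_ge.
Qed.

Lemma cond_prob_infP (A : R -> set T) (B : R -> set T) :
  (forall K, measurable (A K)) -> (forall x, measurable (B x)) ->
  (forall x, 0 < pr (B x)) ->
  (forall K K', K <= K' -> A K `<=` A K') ->
  ereal_inf [set cond_prob P (A K) (B x) | x in `[0, +oo[] @[K --> +oo%R] --> 1%E <->
  forall e : R, 0 < e -> exists K, forall x, 0 <= x ->
    pr (B x `\` A K) <= e * pr (B x).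
Proof.
move=> mA mB B0 Amono.
have := cvg_inf1P (f := fun K x => fine (cond_prob P (A K) (B x))).
move=> /(_ (fun _ _ => cond_prob_le1 (mA _) (mB _))).
move=> /(_ (fun _ _ _ KK => cond_prob_mono (mA _) (mA _) (mB _) (Amono _ _ KK))) H.
apply: (iff_trans H); split=> h e /h[K hx]; exists K => x /hx;
  by rewrite cond_prob_ge.
Qed.

Lemma cond_prob0P (A B : R -> set T) :
  (forall x, 0 < pr (B x)) ->
  cond_prob P (A x) (B x) @[x --> +oo%R] --> 0%E <->
  forall e : R, 0 < e -> exists x0, forall x, x0 <= x ->
    pr (A x `&` B x) <= e * pr (B x).
Proof.
move=> B0.
have := cvg_EFin0P (f := fun x => pr (A x `&` B x) / pr (B x)).
move=> /(_ (fun x => divr_ge0 (pr_ge0 _) (pr_ge0 _))) H.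
apply: (iff_trans H); split=> h e /h[x0 hx]; exists x0 => x /hx;
  by rewrite ler_pdivrMr.
Qed.

Lemma exists_small_tail (Y : {RV P >-> R}) e : 0 < e ->
  exists2 K, 0 <= K & pr [set w | K < Y w] <= e.
Proof.
move=> e0; have := cvg_ccdfy0 Y; move=> /fine_cvg /= /cvgr0Pnorm_le /(_ e e0) [K [_ h]].
exists (Num.max 0 K + 1); first by rewrite addr_ge0// le_max lexx.
have lK : K < Num.max 0 K + 1.
  by rewrite (@le_lt_trans _ _ (Num.max 0 K)) ?le_max ?lexx ?orbT// ltrDl.
have := h _ lK; rewrite /= ger0_norm ?fine_ge0//; apply: le_trans.
by rewrite /pr /ccdf /distribution /pushforward preimage_ray.
Qed.

End real_probability.

(** * Tightness of pairs given a large sum *)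

Section pair_tightness.
Context (R : realType) d (T : measurableType d) (P : probability T R).
Variable X : nat -> {RV P >-> R}.
Hypothesis X_ge0 : forall i w, 0 <= X i w.
Hypothesis indX : mutually_independent X.
Hypothesis idX : forall i j r, cdf (X i) r = cdf (X j) r.

Local Notation pr := (pr P).

Definition tail (a : R) : R := pr [set w | a < X 0 w].

Hypothesis tail_gt0 : forall a, 0 < tail a.

Let measurable_X i a : measurable [set w | a < X i w].
Proof. by apply: measurable_lt_fun; exact: measurable_funPT. Qed.
#[local] Hint Extern 0 (measurable _) => solve [exact: measurable_X] : core.

Let measurable_and (A B : set T) : measurable A -> measurable B ->
  measurable [set w | A w /\ B w].
Proof. exact: measurableI. Qed.

Lemma measurable_psum n : measurable_fun setT (psum X n : T -> R).
Proof. by apply: measurable_sum => i; exact: measurable_funPT. Qed.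

Lemma measurable_sum_gt n x : measurable (sum_gt X n x : set T).
Proof. by apply: measurable_lt_fun; exact: measurable_psum. Qed.
#[local] Hint Extern 0 (measurable _) => solve [exact: measurable_sum_gt] : core.

Lemma measurable_gap n K : measurable [set w | some_gt X n (psum X n w - K) w].
Proof.
apply: measurable_exists => i.
rewrite [X in measurable X](_ : _ = [set w | 0 < X i w + K - psum X n w]).
  apply: measurable_lt_fun; apply: measurable_funB; last exact: measurable_psum.
  by apply: measurable_funD => //; exact: measurable_funPT.
by apply/seteqP; split=> w /=; rewrite subr_gt0 ltrBlDr.
Qed.
#[local] Hint Extern 0 (measurable _) => solve [exact: measurable_gap] : core.

Lemma measurable_some_gt n y : measurable (some_gt X n y : set T).
Proof. by apply: measurable_exists => i; exact: measurable_X. Qed.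
#[local] Hint Extern 0 (measurable _) => solve [exact: measurable_some_gt] : core.

Lemma measurable_two_gt n y : measurable (two_gt X n y : set T).
Proof.
apply: measurable_exists => i; apply: measurable_exists => j.
have [ij|ij] := boolP (i != j).
  rewrite [X in measurable X](_ : _ = [set w | y < X i w] `&` [set w | y < X j w]).
    exact: measurableI.
  by apply/seteqP; split=> w /= []//.
by rewrite [X in measurable X](_ : _ = set0)//; apply/seteqP; split=> w /= [].
Qed.
#[local] Hint Extern 0 (measurable _) => solve [exact: measurable_two_gt] : core.

Lemma pr_tail i a : pr [set w | a < X i w] = tail a.
Proof.
rewrite /tail /pr; congr fine.
have := eq_law idX i 0 (B := `]a, +oo[%classic) (measurable_itv _).
by rewrite !preimage_ray.
Qed.

Lemma pr_pair i j a b : i != j ->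
  pr [set w | a < X i w /\ b < X j w] = tail a * tail b.
Proof.
move=> ij.
pose s (k : 'I_2) := if val k == 0%N then i else j.
have s_inj : injective s.
  move=> [[|[|//]] ?] [[|[|//]] ?]; rewrite /s /= => h; apply/val_inj => //=;
    by rewrite h eqxx in ij.
pose B (k : 'I_2) : set R := if val k == 0%N then `]a, +oo[%classic else `]b, +oo[%classic.
have mB k : measurable (B k) by rewrite /B; case: ifP.
have := prob_inj indX idX s_inj mB.
rewrite !big_ord_recl big_ord0 mule1 /B /= => H.
apply: EFin_inj; rewrite EFinM /tail -!prE//; last exact: measurable_and.
rewrite -!preimage_ray -H; congr (P _); apply/seteqP; split=> w /=.
  by move=> [ha hb] k; rewrite /s /B; case: ifP; rewrite /= in_itv /= andbT.
move=> h; have := h ord0; have := h (lift ord0 ord0).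
by rewrite /s /B /= !in_itv /= !andbT.
Qed.

Lemma ler_psum n w : psum X n w <= psum X n.+1 w.
Proof. by rewrite [leRHS]/psum big_ord_recr /= lerDl. Qed.

Lemma X01_le_psum n w : (1 < n)%N -> X 0 w + X 1 w <= psum X n w.
Proof.
case: n => [|[|n]]// _; rewrite /psum !big_ord_recl /= addrA lerDl sumr_ge0//.
Qed.

(** A lower bound at the scale of a single big jump: one variable supplies
    x - a and another one the remaining a. *)
Lemma sum_gt_ge n a x : (1 < n)%N -> tail (x - a) * tail a <= pr (sum_gt X n x).
Proof.
move=> n1; rewrite -(@pr_pair 0 1)//; apply: pr_le.
- exact: measurable_and.
- exact: measurable_sum_gt.
- move=> w /= [h1 h2]; rewrite /sum_gt /=; apply: lt_le_trans (X01_le_psum w n1).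
  by have := ltrD h1 h2; rewrite subrK.
Qed.

Lemma sum_gt_gt0 n x : (1 < n)%N -> 0 < pr (sum_gt X n x).
Proof. by move=> n1; apply: lt_le_trans (sum_gt_ge x x n1); rewrite mulr_gt0. Qed.

Lemma sum_gt_le n x y : x <= y -> pr (sum_gt X n y) <= pr (sum_gt X n x).
Proof.
move=> xy; apply: pr_le => //; try exact: measurable_sum_gt.
by move=> w; rewrite /sum_gt /=; exact: le_lt_trans.
Qed.

Definition pair_sum (i j n : nat) (K x : R) : set T :=
  [set w | (K < X i w /\ K < X j w) /\ x < psum X n w].

Lemma measurable_pair_sum i j n K x : measurable (pair_sum i j n K x).
Proof. by apply: measurable_and; [exact: measurable_and|exact: measurable_sum_gt]. Qed.

(** By exchangeability: some permutation of the indices sends 0, 1 to i, j, and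
    it leaves the sum unchanged. *)
Lemma pr_pair_sum n (i j : 'I_n) K x : i != j ->
  pr (pair_sum i j n K x) = pr (pair_sum 0 1 n K x).
Proof.
case: n i j => [|[|n]] i j; [by case: i|by rewrite (ord1 i) (ord1 j)|move=> ij].
pose i0 : 'I_n.+2 := ord0; pose i1 : 'I_n.+2 := lift ord0 ord0.
(* Sending 0 to i may move 1 to some index a other than i; exchanging a with j
   then sends 1 to j and keeps i in place. *)
pose a := tperm i0 i i1.
pose s (k : 'I_n.+2) : 'I_n.+2 := tperm a j (tperm i0 i k).
have s_inj : injective s by move=> k l /perm_inj /perm_inj.
have s0 : s i0 = i.
  rewrite /s tpermL tpermD// 1?eq_sym// /a.
  by apply/eqP => h; have := tpermL i0 i; rewrite {2}h => /perm_inj.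
have s1 : s i1 = j by rewrite /s -/a tpermL.
pose S (t : n.+2.-tuple R) := \sum_k tnth t k.
have mS : measurable_fun setT S by apply: measurable_sum => k; exact: measurable_tnth.
pose E := [set t : n.+2.-tuple R | (K < tnth t i0 /\ K < tnth t i1) /\ x < S t].
have mE : measurable E.
  apply: measurableI; last exact: measurable_lt_fun.
  by apply: measurableI; apply: measurable_lt_fun; exact: measurable_tnth.
have := exchangeable indX idX (s := fun k => val (s k)) (t := val) _ val_inj mE.
move=> /(_ (inj_comp val_inj s_inj)) H.
have SE u w : S (vec X u w) = \sum_(k < n.+2) X (u k) w.
  by apply: eq_bigr => k _; rewrite tnth_mktuple.
rewrite /pr; congr fine; transitivity (P (vec X val @^-1` E)); last first.
  congr (P _); apply/seteqP; split=> w; rewrite /E /preimage /= SE !tnth_mktuple //.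
rewrite -H; congr (P _).
have pS w : psum X n.+2 w = \sum_(k < n.+2) X (s k) w.
  by rewrite /psum (reindex_inj s_inj).
by apply/seteqP; split=> w; rewrite /E /preimage /pair_sum /= SE !tnth_mktuple s0 s1 pS.
Qed.

(** The quantifier over all real x, rather than over large x, is what survives
    conditioning on the next variable, whose value shifts the level x. *)
Definition pair_tight n := forall e : R, 0 < e -> exists2 K, 0 <= K &
  forall x, pr (pair_sum 0 1 n K x) <= e * pr (sum_gt X n x).

(** For x below x0 the right-hand side is at least e P(S_n > x0), a positive
    constant, while P(X 0 > K) tends to 0. *)
Lemma pair_tight_eventually n : (1 < n)%N ->
  (forall e : R, 0 < e -> exists K x0, forall x, x0 <= x ->
    pr (pair_sum 0 1 n K x) <= e * pr (sum_gt X n x)) ->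
  pair_tight n.
Proof.
move=> n1 H e e0; have [K [x0 h]] := H e e0.
have S0 := sum_gt_gt0 x0 n1.
have [K' K'0 hK'] := exists_small_tail (X 0) (mulr_gt0 e0 S0).
exists (Num.max K K'); first by rewrite le_max K'0 orbT.
move=> x; have [lx|lx] := leP x0 x.
  apply: le_trans (h _ lx); apply: pr_le; try exact: measurable_pair_sum.
  by move=> w [[]]; rewrite /pair_sum /= !gt_max => /andP[-> _] /andP[-> _].
apply: (@le_trans _ _ (pr [set w | K' < X 0 w])).
  apply: pr_le => //; first exact: measurable_pair_sum.
  by move=> w [[]]; rewrite /= gt_max => /andP[].
by apply: le_trans hK' _; rewrite ler_pM2l//; apply: sum_gt_le; exact: ltW.
Qed.

Lemma pair_tight_two n : pair_tight n ->
  forall e : R, 0 < e -> exists2 K, 0 <= K &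
  forall x, pr (two_gt X n K `&` sum_gt X n x) <= e * pr (sum_gt X n x).
Proof.
move=> H e e0.
(* The number of pairs of indices, plus one to keep it positive. *)
pose N : R := (n * n).+1%:R.
have N0 : 0 < N by rewrite ltr0n.
have [K K0 h] := H (e / N) (divr_gt0 e0 N0).
exists K => // x.
pose A (p : 'I_n * 'I_n) := if p.1 != p.2 then pair_sum p.1 p.2 n K x else set0.
have mA p : measurable (A p).
  by rewrite /A; case: ifP => // _; exact: measurable_pair_sum.
apply: (@le_trans _ _ (pr [set w | exists p, A p w])).
  apply: pr_le; [|exact: measurable_exists|].
    by apply: measurableI => //; exact: measurable_sum_gt.
  by move=> w [[i [j [ij hi hj]]] hS]; exists (i, j); rewrite /A ij.
apply: le_trans (pr_exists P mA) _.
apply: (@le_trans _ _ (\sum_(p : 'I_n * 'I_n) e / N * pr (sum_gt X n x))).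
  apply: ler_sum => -[i j] _; rewrite /A /=; case: ifP => [ij|_].
    by rewrite pr_pair_sum.
  have -> : pr set0 = 0 by rewrite /pr measure0.
  by apply: mulr_ge0; [apply: divr_ge0; exact: ltW|exact: pr_ge0].
rewrite sumr_const card_prod card_ord -mulr_natr.
set S := pr _; have -> : e / N * S * (n * n)%:R = e * S * ((n * n)%:R / N) by ring.
apply: ler_piMr; first by apply: mulr_ge0; [exact: ltW|exact: pr_ge0].
by rewrite ler_pdivrMr// mul1r ler_nat leqnSn.
Qed.

Lemma pair_tight_of_two n : (1 < n)%N ->
  (forall e : R, 0 < e -> exists K x0, forall x, x0 <= x ->
    pr (two_gt X n K `&` sum_gt X n x) <= e * pr (sum_gt X n x)) ->
  pair_tight n.
Proof.
move=> n1 H; apply: pair_tight_eventually => // e /H[K [x0 h]].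
exists K, x0 => x /h; apply: le_trans; apply: pr_le.
- exact: measurable_pair_sum.
- by apply: measurableI => //; exact: measurable_sum_gt.
- case: n n1 {H h} => [|[|n]]// _ w [[h0 h1] hS]; split=> //.
  by exists ord0, (lift ord0 ord0).
Qed.

(** If at most one term exceeds K, that term lies within n K of the sum. *)
Lemma pair_tight_gap n : (0 < n)%N -> pair_tight n ->
  forall e : R, 0 < e -> exists2 K, 0 <= K & forall x,
    pr (sum_gt X n x `\` [set w | some_gt X n (psum X n w - K) w]) <= e * pr (sum_gt X n x).
Proof.
move=> n0 H e /(pair_tight_two H)[K K0 h].
(* The extra 1 turns the bound of the single big jump into a strict one. *)
exists (n%:R * K + 1).
  by rewrite addr_ge0// mulr_ge0.
move=> x; apply: le_trans (h x); apply: pr_le.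
- by apply: measurableD => //; exact: measurable_sum_gt.
- by apply: measurableI => //; exact: measurable_sum_gt.
- move=> w [hS hno]; split=> //; apply: contrapT => no.
  have [i hi] := psum_le_one_big (fun i => X_ge0 i w) n0 K0 no.
  by apply: hno; exists i; rewrite opprD addrA ltrBlDr ltrBlDr -addrA [1 + _]addrC addrA ltr_pwDr.
Qed.

(** On the event that X 0 and X 1 exceed K' while some X i exceeds x - K, one of
    the two indices 0, 1 differs from i; by independence this has probability at
    most n P(X > x - K) P(X > K'), and n P(X > K') is negligible before the
    factor P(X > K) of the lower bound [sum_gt_ge] once K' is large. *)
Lemma pair_tight_of_some n : (1 < n)%N ->
  (forall e : R, 0 < e -> exists K x0, forall x, x0 <= x ->
    pr (sum_gt X n x `\` some_gt X n (x - K)) <= e * pr (sum_gt X n x)) ->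
  pair_tight n.
Proof.
move=> n1 H; apply: pair_tight_eventually => // e e0.
have e20 : 0 < e / 2 by rewrite divr_gt0.
have [K [x0 h]] := H _ e20.
have nR0 : 0 < n%:R :> R by rewrite ltr0n ltnW.
have [K' K'0 hK'] := exists_small_tail (X 0) (divr_gt0 (mulr_gt0 e20 (tail_gt0 K)) nR0).
rewrite -/(tail K') in hK'.
exists K', x0 => x lx.
(* An index among 0, 1 that differs from i. *)
pose o (i : 'I_n) : nat := if val i == 0%N then 1%N else 0%N.
have oi i : nat_of_ord i != o i by rewrite /o /=; case: (nat_of_ord i).
pose A (i : 'I_n) := [set w | x - K < X i w /\ K' < X (o i) w].
have mA i : measurable (A i) by exact: measurable_and.
apply: (@le_trans _ _
  (pr ((sum_gt X n x `\` some_gt X n (x - K)) `|` [set w | exists i, A i w]))).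
  have mD : measurable (sum_gt X n x `\` some_gt X n (x - K) : set T).
    by apply: measurableD => //; exact: measurable_sum_gt.
  apply: pr_le; [exact: measurable_pair_sum| |].
    by apply: measurableU => //; exact: measurable_exists.
  move=> w [[h0 h1] hS].
  have [[i hi]|no] := pselect (some_gt X n (x - K) w); last by left.
  by right; exists i; split=> //; rewrite /o; case: ifP.
apply: le_trans (pr_setU P _ _) _.
- by apply: measurableD => //; exact: measurable_sum_gt.
- exact: measurable_exists.
rewrite [e]splitr mulrDl; apply: lerD; first exact: h.
apply: le_trans (pr_exists P mA) _.
rewrite (eq_bigr (fun=> tail (x - K) * tail K')); last by move=> i _; rewrite pr_pair.
rewrite sumr_const card_ord -[_ *+ n]mulr_natr -mulrA.
apply: (@le_trans _ _ (tail (x - K) * (e / 2 * tail K))).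
  by rewrite ler_pM2l// -ler_pdivlMr.
by rewrite mulrCA ler_pM2l// sum_gt_ge.
Qed.

Lemma pair_tight_some n : (0 < n)%N -> pair_tight n ->
  forall e : R, 0 < e -> exists2 K, 0 <= K & forall x,
    pr (sum_gt X n x `\` some_gt X n (x - K)) <= e * pr (sum_gt X n x).
Proof.
move=> n0 H e /(pair_tight_gap n0 H)[K K0 h]; exists K => // x.
apply: le_trans (h x); apply: pr_le.
- by apply: measurableD => //; exact: measurable_sum_gt.
- by apply: measurableD => //; exact: measurable_sum_gt.
- move=> w [hS no]; split=> // -[i hi]; apply: no; exists i.
  by apply: le_lt_trans hi; rewrite lerD2r ltW.
Qed.

(** Given X n = z, the event S_{n+1} > x becomes S_n > x - z, at which level the
    bound for n applies; no limit in x is involved, so it can be integrated. *)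
Lemma pair_tight_succ n : (1 < n)%N -> pair_tight n -> pair_tight n.+1.
Proof.
case: n => [|[|n]]// _ H e /[dup] e0 /H[K K0 h]; exists K => // x.
pose i0 : 'I_n.+2 := ord0; pose i1 : 'I_n.+2 := lift ord0 ord0.
pose E := [set t : n.+2.-tuple R | K < tnth t i0 /\ K < tnth t i1].
have mE : measurable E.
  by apply: measurableI; apply: measurable_lt_fun; exact: measurable_tnth.
have EE : pair_sum 0 1 n.+3 K x = [set w | E (vec X (@nat_of_ord n.+2) w) /\ x < psum X n.+3 w].
  by apply/seteqP; split=> w; rewrite /E /pair_sum /= !tnth_mktuple.
have TE y m : sum_gt X m y =
    [set w | [set: n.+2.-tuple R] (vec X (@nat_of_ord n.+2) w) /\ y < psum X m w].
  by apply/seteqP; split=> w //= [].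
rewrite -lee_fin EFinM -!prE; [|exact: measurable_sum_gt|exact: measurable_pair_sum].
rewrite EE TE !prob_add_next//.
pose f z := pr (pair_sum 0 1 n.+2 K (x - z)).
pose g z := pr (sum_gt X n.+2 (x - z)).
have fE z :
    P [set w | E (vec X (@nat_of_ord n.+2) w) /\ x - z < psum X n.+2 w] = (f z)%:E.
  rewrite /f -prE; last exact: measurable_pair_sum.
  by congr (P _); apply/seteqP; split=> w; rewrite /E /pair_sum /= !tnth_mktuple.
have gE z :
    P [set w | [set: n.+2.-tuple R] (vec X (@nat_of_ord n.+2) w) /\
       x - z < psum X n.+2 w] = (g z)%:E.
  by rewrite -TE prE.
under eq_integral do rewrite fE.
under [in leRHS]eq_integral do rewrite gE.
have mf : measurable_fun setT (EFin \o f).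
  apply/measurable_EFinP; apply: nondecreasing_measurable => // y z yz.
  apply: pr_le; try exact: measurable_pair_sum.
  by move=> w [hp hS]; split=> //; apply: le_lt_trans hS; rewrite lerD2l lerN2.
have mg : measurable_fun setT (EFin \o g).
  apply/measurable_EFinP; apply: nondecreasing_measurable => // y z yz.
  by apply: sum_gt_le; rewrite lerD2l lerN2.
rewrite -ge0_integralZl_EFin//; last 2 first.
- by move=> z _; rewrite lee_fin pr_ge0.
- exact: ltW.
apply: ge0_le_integral => //.
- by move=> z _; rewrite lee_fin pr_ge0.
- exact: (measurable_funeM e%:E mg).
- by move=> z _; rewrite -EFinM lee_fin; exact: h.
Qed.

(** Adding a nonnegative variable enlarges the pair event, so it suffices that
    P(S_{n+1} > x) is at most a constant times P(S_n > x). Tightness at e = 1/2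
    gives P(S_{n+1} > x) <= 2 (n + 1) P(X > x - a) for some fixed a, and
    [sum_gt_ge] bounds P(X > x - a) P(X > a) by P(S_n > x). *)
Lemma pair_tight_pred n : (1 < n)%N -> pair_tight n.+1 -> pair_tight n.
Proof.
move=> n1 H; apply: pair_tight_eventually => // e e0.
have [K K0 hK] := pair_tight_two H (divr_gt0 ltr01 (ltr0Sn R 1)).
pose N : R := n.+1%:R.
have N0 : 0 < N by rewrite ltr0n.
pose a := N * K.
have comp x : pr (sum_gt X n.+1 x) * tail a <= 2 * N * pr (sum_gt X n x).
  have S_le : pr (sum_gt X n.+1 x) <= 2^-1 * pr (sum_gt X n.+1 x) + N * tail (x - a).
    pose A (i : 'I_n.+1) := [set w | x - a < X i w].
    apply: (@le_trans _ _
      (pr ((two_gt X n.+1 K `&` sum_gt X n.+1 x) `|` [set w | exists i, A i w]))).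
      apply: pr_le; first exact: measurable_sum_gt.
        apply: measurableU; last exact: measurable_exists.
        by apply: measurableI => //; exact: measurable_sum_gt.
      move=> w hS; have [two|no] := pselect (two_gt X n.+1 K w); first by left.
      right; have [i hi] := psum_le_one_big (fun i => X_ge0 i w) (ltn0Sn n) K0 no.
      by exists i; rewrite /A /= ltrBlDr; apply: lt_le_trans hi.
    apply: le_trans (pr_setU P _ _) _.
    - by apply: measurableI => //; exact: measurable_sum_gt.
    - exact: measurable_exists.
    apply: lerD; first by have := hK x; rewrite div1r.
    apply: le_trans (pr_exists P _) _ => //.
    rewrite (eq_bigr (fun=> tail (x - a))); last by move=> i _; rewrite pr_tail.
    by rewrite sumr_const card_ord mulr_natl.
  have {}S_le : pr (sum_gt X n.+1 x) <= 2 * N * tail (x - a) by lra.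
  apply: (@le_trans _ _ (2 * N * tail (x - a) * tail a)).
    by rewrite ler_pM2r.
  by rewrite -mulrA ler_pM2l ?mulr_gt0// sum_gt_ge.
have N20 : 0 < 2 * N by rewrite mulr_gt0.
have [K' K'0 hK'] := H (e * tail a / (2 * N)) (divr_gt0 (mulr_gt0 e0 (tail_gt0 a)) N20).
exists K', 0 => x _; apply: (@le_trans _ _ (pr (pair_sum 0 1 n.+1 K' x))).
  apply: pr_le; try exact: measurable_pair_sum.
  by move=> w [h hS]; split=> //; apply: lt_le_trans hS (ler_psum n w).
apply: le_trans (hK' x) _.
rewrite -mulrA [_ ^-1 * _]mulrC mulrA ler_pdivrMr// -!mulrA ler_pM2l//.
by rewrite mulrC [leRHS]mulrC; exact: comp.
Qed.

End pair_tightness.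

(** * The classes in terms of tightness of pairs *)

Section classes.
Context (R : realType) d (T : measurableType d) (P : probability T R).
Variable X : nat -> {RV P >-> R}.
Hypothesis X_ge0 : forall i w, 0 <= X i w.
Hypothesis indX : mutually_independent X.
Hypothesis idX : forall i j r, cdf (X i) r = cdf (X j) r.
Hypothesis tail_gt0 : forall a, 0 < tail X a.
Variable n : nat.
Hypothesis n1 : (1 < n)%N.

Let n0 : (0 < n)%N := ltnW n1.
Let S_gt0 x : 0 < pr P (sum_gt X n x) := sum_gt_gt0 X_ge0 indX idX tail_gt0 x n1.
Let mS x : measurable (sum_gt X n x : set T) := measurable_sum_gt X n x.

Let kth2E K : [set w | kth_largest X 2 n w <= K] = ~` two_gt X n K.
Proof.
by apply/seteqP; split=> w /=; rewrite leNgt -(kth_largest2 X K w n1) => /negP.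
Qed.

Let two_gt_le K K' : K <= K' -> ~` two_gt X n K `<=` ~` two_gt X n K'.
Proof.
move=> KK; apply: subsetC => w [i [j [ij hi hj]]].
by exists i, j; split=> //; apply: le_lt_trans KK _.
Qed.

Let setD_two x K : sum_gt X n x `\` ~` two_gt X n K = two_gt X n K `&` sum_gt X n x.
Proof. by rewrite setDE setCK setIC. Qed.

Lemma second_bounded_einfP : limf_einf (fun x : R =>
    cond_prob P [set w | kth_largest X 2 n w <= K] (sum_gt X n x)) +oo%R
    @[K --> +oo%R] --> 1%E <-> pair_tight X n.
Proof.
under eq_fun do rewrite kth2E.
apply: (iff_trans (cond_prob_einfP (A := fun K _ => ~` two_gt X n K) _ mS S_gt0 _)).
- by move=> K _; apply: measurableC; exact: measurable_two_gt.
- by move=> K K' _; exact: two_gt_le.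
split=> H.
  apply: pair_tight_of_two => // e /H[K [x0 h]]; exists K, x0 => x /h.
  by rewrite setD_two.
move=> e /(pair_tight_two indX idX H)[K _ h]; exists K, 0 => x _.
by rewrite setD_two.
Qed.

Lemma second_bounded_infP : ereal_inf [set cond_prob P [set w | kth_largest X 2 n w <= K]
    (sum_gt X n x) | x in `[0, +oo[] @[K --> +oo%R] --> 1%E <-> pair_tight X n.
Proof.
under eq_fun do rewrite kth2E.
apply: (iff_trans (cond_prob_infP (A := fun K => ~` two_gt X n K) _ mS S_gt0 two_gt_le)).
  by move=> K; apply: measurableC; exact: measurable_two_gt.
split=> H.
  apply: pair_tight_of_two => // e /H[K h]; exists K, 0 => x /h.
  by rewrite setD_two.
move=> e /(pair_tight_two indX idX H)[K _ h]; exists K => x _.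
by rewrite setD_two.
Qed.

Lemma some_near_level_einfP : limf_einf (fun x : R =>
    cond_prob P (some_gt X n (x - K)) (sum_gt X n x)) +oo%R
    @[K --> +oo%R] --> 1%E <-> pair_tight X n.
Proof.
apply: (iff_trans (cond_prob_einfP (A := fun K x => some_gt X n (x - K)) _ mS S_gt0 _)).
- by move=> K x; exact: measurable_some_gt.
- move=> K K' x KK w [i hi]; exists i; apply: le_lt_trans hi.
  by rewrite lerD2l lerN2.
split=> H.
  by apply: pair_tight_of_some.
by move=> e /(pair_tight_some X_ge0 indX idX n0 H)[K _ h]; exists K, 0.
Qed.

Lemma max_near_level_einfP : limf_einf (fun x : R =>
    cond_prob P [set w | x - K < kth_largest X 1 n w] (sum_gt X n x)) +oo%R
    @[K --> +oo%R] --> 1%E <-> pair_tight X n.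
Proof.
rewrite -some_near_level_einfP.
have E K x : [set w | x - K < kth_largest X 1 n w] = some_gt X n (x - K).
  by apply/seteqP; split=> w /(kth_largest1 X _ w n0).
by under eq_fun => K do under eq_fun => x do rewrite E.
Qed.

Lemma bigmax_near_level_einfP : limf_einf (fun x : R =>
    cond_prob P [set w | x - K < \big[Num.max/0]_(i < n) X i w] (sum_gt X n x)) +oo%R
    @[K --> +oo%R] --> 1%E <-> pair_tight X n.
Proof.
rewrite -some_near_level_einfP.
have E K x : [set w | x - K < \big[Num.max/0]_(i < n) X i w] = some_gt X n (x - K).
  apply/funext => w; apply/propext.
  by apply: (@bigmax_some_gt R T X n (x - K) w) => // i; exact: X_ge0.
by under eq_fun => K do under eq_fun => x do rewrite E.
Qed.

Lemma max_near_sum_einfP : limf_einf (fun x : R =>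
    cond_prob P [set w | psum X n w - K < kth_largest X 1 n w] (sum_gt X n x)) +oo%R
    @[K --> +oo%R] --> 1%E <-> pair_tight X n.
Proof.
pose A K := [set w | some_gt X n (psum X n w - K) w].
have E K : [set w | psum X n w - K < kth_largest X 1 n w] = A K.
  by apply/seteqP; split=> w /(kth_largest1 X _ w n0).
under eq_fun do rewrite E.
apply: (iff_trans (cond_prob_einfP (A := fun K _ => A K) _ mS S_gt0 _)).
- by move=> K _; exact: measurable_gap.
- move=> K K' _ KK w [i hi]; exists i; apply: le_lt_trans hi.
  by rewrite lerD2l lerN2.
split=> H; last first.
  by move=> e /(pair_tight_gap X_ge0 indX idX n0 H)[K _ h]; exists K, 0.
apply: pair_tight_of_some => // e /H[K [x0 h]]; exists K, x0 => x /h.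
apply: le_trans; apply: pr_le.
- by apply: measurableD => //; exact: measurable_some_gt.
- by apply: measurableD => //; exact: measurable_gap.
- move=> w [hS no]; split=> // -[i hi]; apply: no; exists i.
  by apply: le_lt_trans hi; rewrite lerD2r ltW.
Qed.

(** The converse implication diagonalises: points u_k >= k at which the bound
    fails for the threshold k are collected into the single function
    g(x) = min {k | x <= u_k}, for which the limit cannot vanish. *)
Lemma second_negligible_cvgP : (forall g : R -> R, calG g ->
    cond_prob P [set w | g x < kth_largest X 2 n w] (sum_gt X n x)
      @[x --> +oo%R] --> 0%E) <-> pair_tight X n.
Proof.
have E y : [set w | y < kth_largest X 2 n w] = two_gt X n y.
  by apply/seteqP; split=> w /(kth_largest2 X _ w n1).
have GP (g : R -> R) : cond_prob P [set w | g x < kth_largest X 2 n w] (sum_gt X n x)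
      @[x --> +oo%R] --> 0%E <-> forall e, 0 < e -> exists x0, forall x, x0 <= x ->
   pr P (two_gt X n (g x) `&` sum_gt X n x) <= e * pr P (sum_gt X n x).
  under eq_fun do rewrite E.
  exact: (cond_prob0P (fun x => two_gt X n (g x)) S_gt0).
split=> H; last first.
  move=> g [g0 gmono gub]; apply/GP => e /(pair_tight_two indX idX H)[K _ h].
  have [y y0 Ky] := gub K; exists y => x yx.
  apply: le_trans (h x); apply: pr_le.
  - by apply: measurableI => //; exact: measurable_two_gt.
  - by apply: measurableI => //; exact: measurable_two_gt.
  - move=> w [[i [j [ij hi hj]]] hS]; split=> //; exists i, j.
    by have Kg := lt_le_trans Ky (gmono _ _ y0 yx); split=> //; apply: lt_trans Kg _.
apply: pair_tight_of_two => // e e0; apply: contrapT => no.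
have bad (k : nat) : exists x, k%:R <= x /\
    e * pr P (sum_gt X n x) < pr P (two_gt X n k%:R `&` sum_gt X n x).
  apply: contrapT => nok; apply: no; exists k%:R, k%:R => x kx.
  by rewrite leNgt; apply/negP => h; apply: nok; exists x.
have [u hu] := choice bad.
have exu x : exists k, x <= u k.
  exists (Num.bound x); apply: le_trans (hu _).1.
  exact: ltW (ltr_bound x).
pose g x : R := (ex_minn (exu x))%:R.
have gG : calG g.
  split=> [x _|x y _ xy|M]; first by rewrite /g.
  - rewrite /g ler_nat; case: ex_minnP => a _ amin; case: ex_minnP => b hb _.
    by apply: amin; exact: le_trans xy hb.
  (* This y lies beyond u_0, ..., u_N, so the minimum defining g y exceeds N. *)
  - pose N := Num.bound M; pose y := 1 + \sum_(k < N.+1) `|u k|.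
    exists y; first by rewrite addr_ge0// sumr_ge0.
    rewrite /g; case: ex_minnP => m hm _.
    apply: lt_le_trans (ltr_bound M) _; rewrite ler_nat leqNgt.
    apply/negP => mN; move: hm; apply/negP; rewrite -ltNge.
    have mN' : (m < N.+1)%N by exact: ltnW.
    rewrite /y (bigD1 (Ordinal mN'))//= addrCA.
    by rewrite (le_lt_trans (ler_norm _))// ltrDl ltr_pwDl// sumr_ge0.
have /GP/(_ e e0)[x0 hx0] := H g gG.
pose k := Num.bound x0.
have x0u : x0 <= u k.
  apply: le_trans (hu _).1; exact: ltW (ltr_bound x0).
have := hx0 _ x0u; apply/negP; rewrite -ltNge; apply: lt_le_trans (hu k).2 _.
have gk : g (u k) <= k%:R.
  by rewrite /g ler_nat; case: ex_minnP => m _; apply.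
apply: pr_le.
- by apply: measurableI => //; exact: measurable_two_gt.
- by apply: measurableI => //; exact: measurable_two_gt.
- move=> w [[i [j [ij hi hj]]] hS]; split=> //; exists i, j.
  by split=> //; apply: le_lt_trans gk _.
Qed.

End classes.

(** If F(a) were 1, the law of a nonnegative variable with distribution function
    F would be supported in [0, a]. *)
Lemma calF_tail_gt0 (R : realType) (F : R -> R) d (T : measurableType d)
    (P : probability T R) (Z : {RV P >-> R}) a :
  calF F -> (forall r, cdf Z r = (F r)%:E) -> 0 < pr P [set w | a < Z w].
Proof.
move=> [d' [T' [P' [Y [Y0 unbdd YF]]]]] ZF.
have ccdfE d1 (T1 : measurableType d1) (P1 : probability T1 R) (W : {RV P1 >-> R}) :
    ccdf W a = (pr P1 [set w | a < W w])%:E.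
  rewrite -prE; last by apply: measurable_lt_fun; exact: measurable_funPT.
  rewrite /ccdf /distribution /pushforward.
  by rewrite preimage_ray.
rewrite lt_def pr_ge0 andbT; apply/negP => /eqP Z0; apply: unbdd.
have Ya : distribution P' Y `]a, +oo[%classic = 0%E.
  by rewrite -[LHS]/(ccdf Y a) ccdf_1_cdf YF -ZF -ccdf_1_cdf ccdfE Z0.
exists `|a|; split; first exact: num_real.
move=> M /ltW aM y hy /=.
have ya : y <= a.
  rewrite leNgt; apply/negP => ay.
  suff : (0 < distribution P' Y `]a, +oo[%classic)%E by rewrite Ya ltxx.
  by apply: hy; [exact: interval_open|rewrite /= in_itv /= andbT].
have y0 : 0 <= y.
  rewrite leNgt; apply/negP => ylt0.
  suff : (0 < distribution P' Y `]-oo, (0%R : R)[%classic)%E.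
    rewrite (_ : distribution P' Y _ = 0%E) ?ltxx//.
    rewrite /distribution /pushforward (_ : _ @^-1` _ = set0) ?measure0//.
    by apply/seteqP; split=> w //; rewrite /preimage /= in_itv /= ltNge Y0.
  by apply: hy; [exact: interval_open|rewrite /= in_itv].
by rewrite ger0_norm// (le_trans ya)// (le_trans (ler_norm a)).
Qed.

(** A realisation of F serving for one class serves for the other. *)
Lemma eq_class_of (R : realType)
    (Q Q' : forall (d : measure_display) (T : measurableType d)
           (P : probability T R), (nat -> {RV P >-> R}) -> Prop) :
  (forall d (T : measurableType d) (P : probability T R) (X : nat -> {RV P >-> R}),
    (forall i w, 0 <= X i w) -> mutually_independent X ->
    (forall i j r, cdf (X i) r = cdf (X j) r) -> (forall a, 0 < tail X a) ->
    Q d T P X <-> Q' d T P X) ->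
  class_of Q = class_of Q'.
Proof.
move=> QQ; have H (F : R -> R) d (T : measurableType d) (P : probability T R)
    (X : nat -> {RV P >-> R}) : calF F -> iid_nonneg F X -> Q d T P X <-> Q' d T P X.
  move=> hF [X0 XF indX]; apply: QQ => // [i j r|a]; first by rewrite !XF.
  exact: calF_tail_gt0 hF (XF 0).
by apply/seteqP; split=> F [hF [d [T [P [X [iX qX]]]]]]; split=> //;
  exists d, T, P, X; split=> //; apply/(H F).
Qed.

Theorem proposition3 (R : realType) (n : nat) (hn : (2 <= n)%N) :
  [/\ classJn R n = classJ1 R n,
      classJ1 R n = classJ2 R n,
      classJ2 R n = classJ3 R n &
      classJ3 R n = classJ4 R n] /\
  classJn R n = classJn R n.+1 /\
  classJ R = classJn R 2.
Proof.
split; first split; try (apply: eq_class_of => d T P X X0 indX idX tail0).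
- apply: (iff_trans (second_negligible_cvgP X0 indX idX tail0 hn)).
  by apply: iff_sym; exact: second_bounded_einfP.
- apply: (iff_trans (second_bounded_einfP X0 indX idX tail0 hn)).
  by apply: iff_sym; exact: second_bounded_infP.
- apply: (iff_trans (second_bounded_infP X0 indX idX tail0 hn)).
  by apply: iff_sym; exact: max_near_level_einfP.
- apply: (iff_trans (max_near_level_einfP X0 indX idX tail0 hn)).
  by apply: iff_sym; exact: max_near_sum_einfP.
split; apply: eq_class_of => d T P X X0 indX idX tail0.
  apply: (iff_trans (second_negligible_cvgP X0 indX idX tail0 hn)).
  apply: (iff_trans _ (iff_sym (second_negligible_cvgP X0 indX idX tail0 (leqW hn)))).
  by split; [exact: pair_tight_succ|exact: pair_tight_pred].
apply: (iff_trans _ (iff_sym (second_negligible_cvgP X0 indX idX tail0 (ltnSn 1)))); split=> H.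
  by apply/(bigmax_near_level_einfP X0 indX idX tail0 (ltnSn 1)); exact: H.
have Hm m : (1 < m)%N -> pair_tight X m.
  elim: m => [//|[//|[|m]] IH] _; first exact: H.
  by apply: pair_tight_succ => //; exact: IH.
by move=> m m1; apply/(bigmax_near_level_einfP X0 indX idX tail0 m1); exact: Hm.
Qed.
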